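(* Let $N\ge 3$, $h=2\pi/N$, $\theta_i=2\pi i/N$ for $i=0,\dots,N-1$, $\mathbf r_i=(\cos\theta_i,\sin\theta_i)$ and $\mathbf t_i=(-\sin\theta_i,\cos\theta_i)$, with indices taken modulo $N$. Let $(p_i)_{i=0}^{N-1}$ be real numbers satisfying $$\frac{p_{i+1}+p_{i-1}-2p_i\cos h}{2-2\cos h}\ge 0,\qquad i=0,\dots,N-1.$$ Then the polygon $\mathbf A_0\mathbf A_1\dots\mathbf A_{N-1}$ with successive vertices $$\mathbf A_i=p_i\mathbf r_i+\frac{p_{i+1}-p_{i-1}}{2\sin h}\,\mathbf t_i,\qquad i=0,\dots,N-1,$$ is convex.
   Context: Indices are periodic modulo $N$. ''The polygon $\mathbf A_0\dots\mathbf A_{N-1}$ is convex'' means that the closed polygonal line through $\mathbf A_0,\dots,\mathbf A_{N-1}$ in this cyclic order is the boundary of a convex polygon, degenerate cases (coinciding or aligned consecutive vertices, or a polygon with empty interior) being allowed. *)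

(* Defs.v *)
From HB Require Import structures.
From mathcomp Require Import all_boot all_order all_algebra.
From mathcomp Require Import all_classical all_reals all_analysis.

Set Implicit Arguments.
Unset Strict Implicit.
Unset Printing Implicit Defensive.

Import Order.TTheory GRing.Theory Num.Theory.
Import numFieldNormedType.Exports.

Local Open Scope classical_set_scope.
Local Open Scope ring_scope.

(* Families indexed modulo N are functions on 'I_N; [ordS i] and [ord_pred i]
   are i + 1 and i - 1 modulo N. *)

Definition vec2 (R : realType) (x y : R) : 'rV[R]_2 :=
  \row_(j < 2) if j == 0 then x else y.

Definition angle_step (R : realType) (N : nat) : R := 2 * pi / N%:R.

Definition theta (R : realType) (N : nat) (i : 'I_N) : R := 2 * pi * i%:R / N%:R.

Definition rvec (R : realType) (N : nat) (i : 'I_N) : 'rV[R]_2 :=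
  vec2 (cos (theta R i)) (sin (theta R i)).

Definition tvec (R : realType) (N : nat) (i : 'I_N) : 'rV[R]_2 :=
  vec2 (- sin (theta R i)) (cos (theta R i)).

Definition vertex (R : realType) (N : nat) (p : 'I_N -> R) (i : 'I_N) :
    'rV[R]_2 :=
  p i *: rvec R i +
  ((p (ordS i) - p (ord_pred i)) / (2 * sin (angle_step R N))) *: tvec R i.

Definition segment (R : realType) (x y : 'rV[R]_2) : set 'rV[R]_2 :=
  [set (1 - t) *: x + t *: y | t in `[0, 1]].

Definition closed_polygonal_line (R : realType) (N : nat)
    (A : 'I_N -> 'rV[R]_2) : set 'rV[R]_2 :=
  \bigcup_(i in [set: 'I_N]) segment (A i) (A (ordS i)).

Definition boundary (T : topologicalType) (P : set T) : set T :=
  closure P `\` interior P.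

(* Solid convex polygons: convex hulls of finitely many (at least one) points.
   Segments and points are included. *)
Definition solid_convex_polygon (R : realType) (P : set 'rV[R]_2) : Prop :=
  exists (n : nat) (V : 'I_n.+1 -> 'rV[R]_2),
    P = smallest (@convex_set R 'rV[R]_2) (range V).

(* Once round the cycle, starting from a suitable index a, f is nondecreasing
   for m steps and then nonincreasing for the remaining N - m steps. *)
Definition cyclically_unimodal (R : realType) (N : nat) (f : 'I_N -> R) : Prop :=
  exists (a : 'I_N) (m : nat), forall k : nat, (k < N)%N ->
    let i := iter k (@ordS N) a in
    if (k < m)%N then f i <= f (ordS i) else f (ordS i) <= f i.

(* The polygon A_0 ... A_(N-1) is convex: as a set, its closed polygonal line is
   the boundary of a convex polygon, and the vertices follow this boundary in
   cyclic order. Equality of sets alone would allow the line to wind several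
   times round the boundary, to go back and forth along a side, or, when the
   vertices are collinear, to visit them in any order. The second conjunct
   excludes this: along a line running once round a convex curve, or once to and
   fro along a segment, every linear form u rises once and falls once. Equal or
   aligned consecutive vertices are allowed, and so are both orientations. *)
Definition convex_polygon (R : realType) (N : nat)
    (A : 'I_N -> 'rV[R]_2) : Prop :=
  (exists P : set 'rV[R]_2,
     solid_convex_polygon P /\ closed_polygonal_line A = boundary P) /\
  (forall u : 'cV[R]_2, cyclically_unimodal (fun i => (A i *m u) 0 0)).

(* Main.v *)
Require Import Defs.
From HB Require Import structures.
From mathcomp Require Import all_boot all_order all_algebra.
From mathcomp Require Import all_classical all_reals all_analysis.
From mathcomp Require Import ring lra zify.
Import Order.TTheory GRing.Theory Num.Theory.
Import numFieldNormedType.Exports.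
Local Open Scope ring_scope.

Set Implicit Arguments.
Unset Strict Implicit.
Unset Printing Implicit Defensive.

(* A_i is the midpoint of the side carried by the line x . r_i = p_i in the
   polygon cut out by these lines, so that
   A_(i+1) - A_i = c_i t_i + c_(i+1) t_(i+1) with c_i >= 0 the half sides.
   A vector u in the cone spanned by r_i and r_(i+1) satisfies u . t_j <= 0 and
   then u . t_j >= 0 as j runs from i + 1 round to i, so u . A_j first decreases
   and then increases along this walk (a "valley"). These cones cover the plane,
   which gives unimodality. The outer normal of the edge A_i A_(i+1) lies in the
   i-th cone and takes equal values at both ends of the valley, hence is maximal
   there: every edge lies on a supporting line of the hull. Conversely, a point
   strictly inside all edge halfplanes is interior to the hull, so a boundary
   point lies on the supporting line of an edge; the vertices on this line form an
   unbroken run, again by the valley shape, and its edges cover the face. *)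

(** * Walks round the cyclic index set *)

Lemma val_iter_ordS (N : nat) (i : 'I_N) (k : nat) :
  val (iter k (@ordS N) i) = ((i + k) %% N)%N.
Proof.
elim: k => [|k IHk] /=; first by rewrite addn0 modn_small.
by rewrite IHk -addn1 modnDml addn1 addnS.
Qed.

Lemma iter_pred_ordS (N : nat) (i : 'I_N) :
  iter N.-1 (@ordS N) (ordS i) = i.
Proof.
have N0 : (0 < N)%N by apply: leq_ltn_trans (ltn_ord i).
apply: val_inj; rewrite -iterSr prednK// val_iter_ordS.
by rewrite modnDr modn_small.
Qed.

Lemma iter_ordS_surj (N : nat) (i j : 'I_N) :
  exists2 k, (k < N)%N & j = iter k (@ordS N) i.
Proof.
have N0 : (0 < N)%N by apply: leq_ltn_trans (ltn_ord i).
exists ((j + (N - i)) %% N)%N; first by rewrite ltn_mod.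
apply: val_inj; rewrite val_iter_ordS modnDmr.
have -> : (i + (j + (N - i)) = j + N)%N by have := ltn_ord i; lia.
by rewrite modnDr modn_small.
Qed.

(** * Valleys: values that fall and then rise along a cyclic walk *)

(** The walk has [N.-1] steps, from [ordS i] round to i; the step from i to [ordS i] is left
    free. *)
Definition valley {R : realType} {N : nat} (f : 'I_N -> R) (i : 'I_N) : Prop :=
  exists m : nat, forall k : nat, (k < N.-1)%N ->
    let j := iter k (@ordS N) (ordS i) in
    if (k < m)%N then f (ordS j) <= f j else f j <= f (ordS j).

(** The free step from i to [ordS i] joins the rising or the falling run, according to its
    direction. *)
Lemma valley_unimodal (R : realType) (N : nat) (f : 'I_N -> R) (i : 'I_N) :
  valley (fun j => - f j) i -> cyclically_unimodal f.
Proof.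
case=> m fm; have N0 : (0 < N)%N by apply: leq_ltn_trans (ltn_ord i).
have {}fm k : (k < N.-1)%N -> let j := iter k (@ordS N) (ordS i) in
    if (k < m)%N then f j <= f (ordS j) else f (ordS j) <= f j.
  by move=> /fm/=; rewrite !lerN2.
have [fi|/ltW fi] := leP (f i) (f (ordS i)).
  exists i, m.+1 => -[|k] kN //=.
  have := fm k; rewrite -iterSr /= ltnS; apply; lia.
(* [m] may exceed the number of steps; the cap keeps the free step, now the last one, in the falling
   run. *)
exists (ordS i), (minn m N.-1) => k kN /=.
have [kN1|kN1] := ltnP k N.-1.
  by have := fm _ kN1; rewrite /= leq_min [(k < N.-1)%N]kN1 andbT.
have -> : k = N.-1 by lia.
by rewrite iter_pred_ordS leq_min ltnn andbF.
Qed.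

Section ValleySequences.
Variables (R : realType) (g : nat -> R) (m n : nat).
Hypothesis gm : forall k, (k < n)%N ->
  if (k < m)%N then g k.+1 <= g k else g k <= g k.+1.

Lemma valley_descent (a b : nat) :
  (a <= b)%N -> (b <= m)%N -> (b <= n)%N -> g b <= g a.
Proof.
move=> ab; rewrite -(subnKC ab); elim: (b - a)%N => [|l IHl] lm ln.
  by rewrite addn0.
apply: le_trans (IHl _ _); [|lia|lia].
have := @gm (a + l)%N; rewrite addnS; case: ifP => [_|]; last lia.
by apply; lia.
Qed.

Lemma valley_ascent (a b : nat) :
  (a <= b)%N -> (m <= a)%N -> (b <= n)%N -> g a <= g b.
Proof.
move=> ab ma; rewrite -(subnKC ab); elim: (b - a)%N => [|l IHl] ln.
  by rewrite addn0.
apply: le_trans (IHl _) _; first lia.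
have := @gm (a + l)%N; rewrite addnS; case: ifP => [|_]; first lia.
by apply; lia.
Qed.

End ValleySequences.

(** A value on the descent is at most the one at [ordS i], a value on the ascent at most the one at
    i. *)
Lemma valley_max (R : realType) (N : nat) (f : 'I_N -> R) (i j : 'I_N) :
  valley f i -> f i = f (ordS i) -> f j <= f i.
Proof.
move=> [m fm] fi; have [k kN ->] := iter_ordS_surj (ordS i) j.
have [km|mk] := leqP k m.
  rewrite fi; apply: (@valley_descent _ (fun l => f (iter l (@ordS N) (ordS i)))
    m N.-1 fm 0 k) => //; lia.
rewrite -[in leRHS](iter_pred_ordS i).
apply: (@valley_ascent _ (fun l => f (iter l (@ordS N) (ordS i)))
    m N.-1 fm) => //; lia.
Qed.

(** If j is on the descent, all values from [ordS i] to j are maximal; if on the ascent, all those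
    from j to i are. [P] is carried along this run. *)
Lemma valley_max_connected (R : realType) (N : nat) (f : 'I_N -> R) (i j : 'I_N)
    (P : pred 'I_N) :
  valley f i -> f i = f (ordS i) ->
  (forall l, f l = f i -> f (ordS l) = f i -> P l = P (ordS l)) ->
  f j = f i -> P j = P i.
Proof.
move=> vf fi PS; have fmax l := @valley_max _ _ f i l vf fi.
case: vf => m fm; have [k kN ->] := iter_ordS_surj (ordS i) j => fk.
pose g l := f (iter l (@ordS N) (ordS i)).
have [km|mk] := leqP k m.
  have gl l : (l <= k)%N -> g l = f i.
    move=> lk; apply/eqP; rewrite eq_le fmax -[in leLHS]fk.
    by apply: (valley_descent fm) => //; lia.
  have {}PS l : (l <= k)%N -> P (iter l (@ordS N) (ordS i)) = P i.
    elim: l => [|l IHl] lk /=; first by rewrite -PS.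
    by rewrite -PS ?IHl//; [lia|apply: (gl l); lia|apply: (gl l.+1)].
  exact: PS.
have gl l : (k <= l)%N -> (l < N)%N -> g l = f i.
  move=> kl lN; apply/eqP; rewrite eq_le fmax -[in leLHS]fk.
  by apply: (valley_ascent fm) => //; lia.
have {}PS l : (k + l < N)%N ->
    P (iter k (@ordS N) (ordS i)) = P (iter (k + l) (@ordS N) (ordS i)).
  elim: l => [|l IHl] lk; first by rewrite addn0.
  rewrite IHl; last lia.
  rewrite addnS /= PS//; first by apply: (gl (k + l)%N); lia.
  by apply: (gl (k + l).+1); lia.
have := PS (N.-1 - k)%N; rewrite subnKC; last lia.
by rewrite iter_pred_ordS; apply; lia.
Qed.

(** Among the maximisers of [f] take one that maximises [g]; elsewhere a large multiple of [f]
    outweighs any excess of [g]. *)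
Lemma lex_max (R : realType) (N : nat) (f g : 'I_N -> R) (i : 'I_N) :
  (forall j, f j <= f i) ->
  exists j0, exists C, f j0 = f i /\ forall j, g j + C * f j <= g j0 + C * f i.
Proof.
move=> fmax.
case: (@arg_maxP _ _ _ i (fun j => f j == f i) g (eqxx _)) => j0 /eqP fj0 gmax.
(* The sum of nonnegative terms bounds each quotient; terms with [f j = f i] vanish, as division by
   0 gives 0. *)
exists j0, (\sum_j `|g j - g j0| / (f i - f j)); split=> // j.
have [fj|fj] := eqVneq (f j) (f i).
  by rewrite fj lerD2r; apply: gmax; apply/eqP.
have {}fj : 0 < f i - f j by rewrite subr_gt0 lt_neqAle fj fmax.
set C := \sum_j _.
have : `|g j - g j0| / (f i - f j) <= C.
  rewrite /C (bigD1 j)//= lerDl; apply: sumr_ge0 => l _.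
  by rewrite divr_ge0// subr_ge0.
rewrite ler_pdivrMr// mulrBr => /(le_trans (ler_norm _)); lra.
Qed.

(** * Scalar product and quarter turn in the plane *)

Definition dot (R : realType) (u x : 'rV[R]_2) : R :=
  u 0 0 * x 0 0 + u 0 1 * x 0 1.

(* The quarter turn taking t_i to r_i. *)
Definition turn (R : realType) (u : 'rV[R]_2) : 'rV[R]_2 :=
  vec2 (u 0 1) (- u 0 0).

Section Dot.
Variable R : realType.
Implicit Types u v w x y : 'rV[R]_2.

Lemma vec2_eq x y : x 0 0 = y 0 0 -> x 0 1 = y 0 1 -> x = y.
Proof.
move=> e0 e1; apply/rowP => -[[|[|//]] lt2].
  by rewrite (_ : Ordinal lt2 = 0)//; apply: val_inj.
by rewrite (_ : Ordinal lt2 = 1)//; apply: val_inj.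
Qed.

Lemma dotDr u x y : dot u (x + y) = dot u x + dot u y.
Proof. by rewrite /dot !mxE; ring. Qed.

Lemma dotZr u (a : R) x : dot u (a *: x) = a * dot u x.
Proof. by rewrite /dot !mxE; ring. Qed.

Lemma dotBr u x y : dot u (x - y) = dot u x - dot u y.
Proof. by rewrite /dot !mxE; ring. Qed.

Lemma dotDl u v x : dot (u + v) x = dot u x + dot v x.
Proof. by rewrite /dot !mxE; ring. Qed.

Lemma dotZl (a : R) u x : dot (a *: u) x = a * dot u x.
Proof. by rewrite /dot !mxE; ring. Qed.

Lemma dotNl u x : dot (- u) x = - dot u x.
Proof. by rewrite /dot !mxE; ring. Qed.

Lemma dot_trmx (v : 'cV[R]_2) x : dot v^T x = (x *m v) 0 0.
Proof.
rewrite /dot !mxE big_ord_recl big_ord1 ![v _ _ * _]mulrC.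
by congr (_ + x _ _ * v _ _); apply: val_inj.
Qed.

Lemma dot_turn u x : dot (turn u) x = u 0 1 * x 0 0 - u 0 0 * x 0 1.
Proof. by rewrite /dot !mxE /=; ring. Qed.

Lemma dot_gt0 u : u != 0 -> 0 < dot u u.
Proof.
move=> u0; rewrite /dot -!expr2 lt_neqAle addr_ge0 ?sqr_ge0// andbT eq_sym.
apply: contra u0; rewrite paddr_eq0 ?sqr_ge0// !sqrf_eq0 => /andP[/eqP e0 /eqP e1].
by apply/eqP/vec2_eq; rewrite mxE.
Qed.

(** [u] and [turn u] are orthogonal of equal length, so the two products give the coordinates times
    |u|^2. *)
Lemma dot_turn_inj u x y : u != 0 ->
  dot u x = dot u y -> dot (turn u) x = dot (turn u) y -> x = y.
Proof.
move=> /dot_gt0 u0 e e'.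
have e0 : dot u u * (x 0 0 - y 0 0) = 0.
  have -> : dot u u * (x 0 0 - y 0 0) = u 0 0 * (dot u x - dot u y)
    + u 0 1 * (dot (turn u) x - dot (turn u) y).
    by rewrite !dot_turn /dot; ring.
  by rewrite e e' !subrr !mulr0 addr0.
have e1 : dot u u * (x 0 1 - y 0 1) = 0.
  have -> : dot u u * (x 0 1 - y 0 1) = u 0 1 * (dot u x - dot u y)
    - u 0 0 * (dot (turn u) x - dot (turn u) y).
    by rewrite !dot_turn /dot; ring.
  by rewrite e e' !subrr !mulr0 subr0.
by apply: vec2_eq; apply/eqP; rewrite -subr_eq0;
   [move/eqP: e0|move/eqP: e1]; rewrite mulf_eq0 gt_eqF.
Qed.

Lemma dot_continuous u : continuous (dot u).
Proof.
move=> x; rewrite /dot; apply: (@cvgD _ _ _ (nbhs x));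
  apply: cvgMl_tmp; exact: coord_continuous.
Qed.

End Dot.

(** * Convex hulls and their supporting lines *)

Lemma convex_comb_hull (R : realType) (V : set 'rV[R]_2) (x y : 'rV[R]_2) (t : R) :
  let K := smallest (@convex_set R 'rV[R]_2) V in
  K x -> K y -> 0 <= t -> t <= 1 -> K ((1 - t) *: x + t *: y).
Proof.
move=> K Kx Ky t0 t1 C [cC VC].
have Cx : C x by apply: Kx.
have Cy : C y by apply: Ky.
have t01 : 0 <= 1 - t by rewrite subr_ge0.
have t01' : 1 - t <= 1 by rewrite lerBlDr lerDl.
have := cC x y (Itv01 t01 t01'); rewrite !inE => /(_ Cx Cy).
have -> : (1 - t) *: x + t *: y = (1 - t) *: x + (1 - (1 - t)) *: y by rewrite subKr.
exact.
Qed.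

Lemma segment_hull (R : realType) (V : set 'rV[R]_2) (x y : 'rV[R]_2) :
  let K := smallest (@convex_set R 'rV[R]_2) V in
  K x -> K y -> (segment x y `<=` K)%classic.
Proof.
move=> K Kx Ky z [t]; rewrite /= in_itv /= => /andP[t0 t1] <-.
exact: convex_comb_hull.
Qed.

Lemma closure_hull_halfspace (R : realType) (V : set 'rV[R]_2) (u : 'rV[R]_2) (b : R) :
  (forall x, V x -> dot u x <= b) ->
  forall x, closure (smallest (@convex_set R 'rV[R]_2) V) x -> dot u x <= b.
Proof.
move=> Vb x; rewrite closureE.
apply: (@smallest_sub _ _ _ [set y | dot u y <= b]).
  apply: (@preimage_closed _ _ (dot u) [set r | r <= b]%classic) => //.
  by move=> y _; exact: dot_continuous.
apply: smallest_sub => //.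
move=> y z t; rewrite !inE /= => yb zb.
change (dot u (t%:num *: y + (1 - t%:num) *: z) <= b).
have t0 : 0 <= t%:num by [].
have t1 : 0 <= 1 - t%:num by rewrite subr_ge0.
rewrite dotDr !dotZr.
have -> : b = t%:num * b + (1 - t%:num) * b by ring.
by apply: lerD; apply: ler_wpM2l.
Qed.

Lemma interior_direction (R : realType) (K : set 'rV[R]_2) (x u : 'rV[R]_2) :
  interior K x -> exists2 t : R, 0 < t & K (x + t *: u).
Proof.
move=> Kx.
have Kt : ((x + t *: u) @[t --> (0:R)^'+] --> x)%classic.
  rewrite -[X in (_ --> X)%classic]addr0 -(scale0r u); apply: cvgD; first exact: cvg_cst.
  by apply: cvgZr_tmp; apply: cvg_at_right_filter.
have [t [t0 Kxt]] := filter_ex (filterI (nbhs_right_gt (0 : R)) (Kt _ Kx)).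
by exists t.
Qed.

(** From an interior point one could move a little along [u] inside the hull, pushing [dot u] beyond
    its maximum. *)
Lemma support_not_interior (R : realType) (V : set 'rV[R]_2) (u x : 'rV[R]_2) :
  let K := smallest (@convex_set R 'rV[R]_2) V in
  u != 0 -> (forall y, V y -> dot u y <= dot u x) -> ~ interior K x.
Proof.
move=> K u0 Vx /(interior_direction u)[t t0 Kt].
have := closure_hull_halfspace Vx (subset_closure Kt).
by rewrite dotDr dotZr gerDl leNgt mulr_gt0// dot_gt0.
Qed.

(* Fan triangulation from the end O of the edge [k]: along the other vertices B,
   the cross product of B - O and x - O goes from nonnegative to negative, and x
   lies in the triangle spanned by O and the edge where the sign changes. *)
Lemma strictly_inside_hull (R : realType) (N : nat) (A : 'I_N -> 'rV[R]_2)
    (k : 'I_N) (x : 'rV[R]_2) :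
  A (ordS k) != A k ->
  (forall i, A (ordS i) != A i ->
     dot (turn (A (ordS i) - A i)) x < dot (turn (A (ordS i) - A i)) (A i)) ->
  smallest (@convex_set R 'rV[R]_2) (range A) x.
Proof.
move=> Ak xin; set K := smallest _ _.
have KA i : K (A i) by apply: sub_gen_smallest; exists i.
pose O := A (ordS k); pose B l := A (iter l (@ordS N) (ordS k)).
pose g l := dot (turn (B l - O)) (O - x).
have g0 : 0 <= g 0%N by rewrite /g /B /= dot_turn !mxE; lra.
have gN : g N.-1 < 0.
  have := xin k Ak; rewrite /g /B /O iter_pred_ordS !dot_turn !mxE; lra.
have [l gl gl1] : exists2 l, 0 <= g l & g l.+1 < 0.
  elim: (N.-1) gN => [|n IHn] gn; first by move: g0; rewrite leNgt gn.
  by have [/IHn|gn0] := ltP (g n) 0; [|exists n].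
have KB m : K (B m) by apply: KA.
have AB : A (ordS (iter l (@ordS N) (ordS k))) = B l.+1 by [].
have AB' : A (iter l (@ordS N) (ordS k)) = B l by [].
have := xin (iter l (@ordS N) (ordS k)); rewrite AB AB' => {}xin.
have {}xin : 0 < dot (turn (B l.+1 - B l)) (B l - x).
  rewrite dotBr subr_gt0 xin//; apply: contraTneq gl1 => e.
  by rewrite -leNgt /g e.
move: gl gl1 xin (KB l) (KB l.+1) (KA (ordS k)).
rewrite /g -/O {g0 gN g}; move: (B l) (B l.+1) O => b c o {KB AB AB' B Ak KA}.
(* Up to their positive sum, [l0], [l1], [l2] are the barycentric coordinates of x with respect to
   o, b, c. *)
set l2 := dot _ _ => l2_ge0; rewrite -oppr_gt0; set l1 := - dot _ _ => l1_gt0.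
set l0 := dot _ _ => l0_gt0 Kb Kc Ko.
have s_gt0 : 0 < l1 + l2 by lra.
have D_gt0 : 0 < l0 + (l1 + l2) by lra.
have -> : x = (1 - (l1 + l2) / (l0 + (l1 + l2))) *: o +
    (l1 + l2) / (l0 + (l1 + l2)) *: ((1 - l2 / (l1 + l2)) *: b + (l2 / (l1 + l2)) *: c).
  have {}s_gt0 := lt0r_neq0 s_gt0; have {}D_gt0 := lt0r_neq0 D_gt0.
  apply: vec2_eq; rewrite !mxE; apply: (mulfI D_gt0).
    transitivity (l0 * o 0 0 + l1 * b 0 0 + l2 * c 0 0).
      by rewrite /l0 /l1 /l2 !dot_turn !mxE; ring.
    by field; apply/andP.
  transitivity (l0 * o 0 1 + l1 * b 0 1 + l2 * c 0 1).
    by rewrite /l0 /l1 /l2 !dot_turn !mxE; ring.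
  by field; apply/andP.
have le1 (p q : R) : 0 <= p -> 0 < q -> p / (q + p) <= 1.
  by move=> p0 q0; rewrite ler_pdivrMr ?mul1r ?lerDr ?ltW// ltr_wpDr.
have [l1l2_ge0 l0_ge0] := (ltW s_gt0, ltW l0_gt0).
apply: convex_comb_hull (divr_ge0 _ (ltW D_gt0)) (le1 _ _ _ _) => //.
exact: convex_comb_hull (divr_ge0 _ _) (le1 _ _ _ _).
Qed.
(* The closure of the hull is confined, on the supporting line, to the range of
   the vertices lying there: for v = turn u and v = - turn u and C large, the
   maximum of v + C u over the vertices is reached at a vertex on the line. This
   avoids proving that the hull is closed. *)
Lemma support_line_sides (R : realType) (N : nat) (A : 'I_N -> 'rV[R]_2)
    (i : 'I_N) (u x : 'rV[R]_2) :
  u != 0 -> valley (fun j => dot u (A j)) i ->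
  dot u (A i) = dot u (A (ordS i)) ->
  closure (smallest (@convex_set R 'rV[R]_2) (range A)) x ->
  dot u (A i) <= dot u x -> closed_polygonal_line A x.
Proof.
move=> u0 vu ui Kx ux; apply: contrapT => xA.
have umax j : dot u (A j) <= dot u (A i) := valley_max j vu ui.
have {}ux : dot u x = dot u (A i).
  apply/eqP; rewrite eq_le ux andbT; apply: closure_hull_halfspace Kx.
  by move=> _ [j _ <-].
have vertexP j : x <> A j.
  move=> xj; apply: xA; exists j => //; exists 0.
    by rewrite /= in_itv /= lexx ler01.
  by rewrite subr0 scale1r scale0r addr0.
have bound v : exists2 j, dot u (A j) = dot u (A i) & dot v x <= dot v (A j).
  have [j [C [uj vmax]]] := lex_max (fun j => dot v (A j)) umax.
  exists j => //.
  have : dot (v + C *: u) x <= dot v (A j) + C * dot u (A i).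
    apply: closure_hull_halfspace Kx => _ [l _ <-].
    by rewrite dotDl dotZl.
  by rewrite dotDl dotZl ux lerD2r.
(* [P j] says that A_j comes strictly before x on the supporting line. A change of [P] along an edge
   of this line would put x on that edge. *)
pose P j := dot (turn u) (A j) < dot (turn u) x.
have PS j : dot u (A j) = dot u (A i) -> dot u (A (ordS j)) = dot u (A i) ->
    P j = P (ordS j).
  move=> uj uSj; apply/eqP/negPn/negP => Pj; apply: xA; exists j => //.
  pose t := (dot (turn u) x - dot (turn u) (A j)) /
    (dot (turn u) (A (ordS j)) - dot (turn u) (A j)).
  have [d0 t01] : dot (turn u) (A (ordS j)) - dot (turn u) (A j) != 0 /\ 0 <= t <= 1.
    rewrite /t; move: Pj; rewrite /P.
    case: ltP => h1; case: ltP => h2 // _.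
      have d : 0 < dot (turn u) (A (ordS j)) - dot (turn u) (A j) by lra.
      split; first by rewrite gt_eqF.
      by apply/andP; split; [rewrite divr_ge0|rewrite ler_pdivrMr//]; lra.
    have d : dot (turn u) (A (ordS j)) - dot (turn u) (A j) < 0 by lra.
    split; first by rewrite lt_eqF.
    by rewrite -mulrNN -invrN; apply/andP; split; [rewrite divr_ge0|rewrite ler_pdivrMr]; lra.
  exists t; first by rewrite /= in_itv.
  apply: (dot_turn_inj u0); rewrite dotDr !dotZr.
    by rewrite uj uSj ux; ring.
  by rewrite /t; field.
(* One vertex of the line is at or after x, another at or before it; as [P] is constant on the line,
   the second must equal x. *)
have [j0 uj0 xj0] := bound (turn u).
have [j1 uj1 xj1] := bound (- turn u).
have Pj := valley_max_connected vu ui PS.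
have : P j0 = P j1 by rewrite Pj// Pj.
rewrite /P ltNge xj0 /= => /esym/negbT; rewrite -leNgt => {}xj0'.
apply: (@vertexP j1); apply: (dot_turn_inj u0); first by rewrite ux uj1.
by move: xj1; rewrite !dotNl; lra.
Qed.

Lemma polygonal_line_boundary (R : realType) (N : nat) (A : 'I_N -> 'rV[R]_2) :
  (0 < N)%N ->
  (forall i, exists u, [/\ u != 0,
     A (ordS i) != A i -> u = turn (A (ordS i) - A i),
     dot u (A i) = dot u (A (ordS i)) & valley (fun j => dot u (A j)) i]) ->
  closed_polygonal_line A =
  boundary (smallest (@convex_set R 'rV[R]_2) (range A)).
Proof.
move=> N0 Au; apply/seteqP; split=> x.
  case=> i _ xi; have [u [u0 _ ui vu]] := Au i.
  have KA j : smallest (@convex_set R 'rV[R]_2) (range A) (A j).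
    by apply: sub_gen_smallest; exists j.
  split; first exact: subset_closure (segment_hull (KA _) (KA _) xi).
  apply: support_not_interior u0 _ => _ [j _ <-].
  case: xi => t _ <-; rewrite dotDr !dotZr -ui.
  have -> : (1 - t) * dot u (A i) + t * dot u (A i) = dot u (A i) by ring.
  exact: valley_max vu ui.
case=> Kx intx; apply: contrapT => xA; apply: intx.
(* If all vertices coincide, no edge has a direction, and the closure of the hull is that single
   point. *)
have [[k Ak]|A0] := pselect (exists k, A (ordS k) != A k); last first.
  pose i0 := Ordinal N0; exfalso; apply: xA; exists i0 => //; exists 0.
    by rewrite /= in_itv /= lexx ler01.
  rewrite subr0 scale1r scale0r addr0.
  have A0S i : A (ordS i) = A i by apply/eqP/negPn/negP => Ai; apply: A0; exists i.
  have Aj j : A j = A i0.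
    by have [l _ ->] := iter_ordS_surj i0 j; elim: l => //= l; rewrite A0S.
  have le_x v : dot v x <= dot v (A i0).
    by apply: closure_hull_halfspace Kx => _ [j _ <-]; rewrite Aj.
  have eq_x v : dot v (A i0) = dot v x.
    by apply/eqP; rewrite eq_le le_x andbT -lerN2 -!dotNl.
  have [u [u0 _ _ _]] := Au i0.
  exact: (dot_turn_inj u0).
have xin i : A (ordS i) != A i ->
    dot (turn (A (ordS i) - A i)) x < dot (turn (A (ordS i) - A i)) (A i).
  have [u [u0 uA ui vu]] := Au i => /uA <-.
  rewrite ltNge; apply/negP => ux; apply: xA.
  exact: support_line_sides u0 vu ui Kx ux.
(* Finitely many strict inequalities persist near x, and every point satisfying them is in the
   hull. *)
suff : \forall y \near x, forall i, A (ordS i) != A i ->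
    dot (turn (A (ordS i) - A i)) y < dot (turn (A (ordS i) - A i)) (A i).
  apply: filterS => y; exact: strictly_inside_hull Ak.
apply: (@filter_forall _ _ (fun i y => A (ordS i) != A i ->
    dot (turn (A (ordS i) - A i)) y < dot (turn (A (ordS i) - A i)) (A i)) (nbhs x) _) => i.
have [Ai|Ai] := eqVneq (A (ordS i)) (A i); first by apply: nearW => y /negP.
set v := turn _.
have := @dot_continuous _ v x _
  (open_nbhs_nbhs (conj (@open_lt R (dot v (A i))) (xin i Ai))).
by move=> vx; apply: (@filterS _ (nbhs x) _ _ _ _ vx).
Qed.

(** * The directions r_i and t_i of the regular polygon *)

Section RegularDirections.
Variables (R : realType) (N : nat).
Hypothesis N3 : (3 <= N)%N.
Local Notation h := (angle_step R N).

Let N_gt0 : 0 < N%:R :> R.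
Proof. by rewrite ltr0n (leq_trans _ N3). Qed.

Lemma N_angle_step : N%:R * h = 2 * pi.
Proof. by rewrite /angle_step; field; rewrite gt_eqF. Qed.

Lemma sin_angle_step_gt0 : 0 < sin h.
Proof.
have N3R : 3 <= N%:R :> R by rewrite ler_nat.
have pi0 := pi_gt0 R.
apply: sin_gt0_pi; rewrite /angle_step divr_gt0 ?mulr_gt0//=.
by rewrite ltr_pdivrMr// [ltLHS]mulrC ltr_pM2l//; lra.
Qed.

Lemma cos_angle_step_lt1 : cos h < 1.
Proof.
have := sin_angle_step_gt0; have := cos2Dsin2 h; have := cos_le1 h.
rewrite [cos h < 1]lt_neqAle => -> + s0; rewrite andbT; apply: contraPneq => ->.
by have := mulr_gt0 s0 s0; nra.
Qed.

Lemma sin_multiple_ge0 (k : nat) : (k.*2 <= N)%N -> 0 <= sin (k%:R * h).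
Proof.
move=> kN; have pi0 := pi_gt0 R.
have kNR : 2 * k%:R <= N%:R :> R by rewrite -natrM mul2n ler_nat.
apply: sin_ge0_pi; apply/andP; split.
  by rewrite /angle_step mulr_ge0// divr_ge0 ?mulr_ge0// ltW.
have -> : k%:R * h = 2 * k%:R * pi / N%:R by rewrite /angle_step; ring.
by rewrite ler_pdivrMr// mulrC ler_pM2l.
Qed.

Lemma sin_multiple_le0 (k : nat) :
  (N <= k.*2)%N -> (k <= N)%N -> sin (k%:R * h) <= 0.
Proof.
move=> Nk kN; have := @sin_multiple_ge0 (N - k) _; rewrite natrB//.
have -> : (N%:R - k%:R) * h = - (k%:R * h) + pi + pi.
  by rewrite mulrBl N_angle_step; ring.
by rewrite !sinDpi opprK sinN oppr_ge0; apply; lia.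
Qed.

(** At the last index [theta] jumps back by 2 pi, so it is only the cosine and sine that always
    advance by h. *)
Lemma theta_ordS (i : 'I_N) :
  cos (theta R (ordS i)) = cos (theta R i + h) /\
  sin (theta R (ordS i)) = sin (theta R i + h).
Proof.
have e : theta R i + h = 2 * pi * i.+1%:R / N%:R.
  by rewrite /theta /angle_step -natr1; field; rewrite gt_eqF.
rewrite e /theta /=; have [iN|Ni] := ltnP i.+1 N; first by rewrite modn_small.
have -> : i.+1 = N by apply/eqP; rewrite eqn_leq Ni ltn_ord.
rewrite modnn mulr0 mul0r mulfK ?gt_eqF// cos0 sin0.
have -> : 2 * pi = pi + pi :> R by ring.
by rewrite cosDpi sinDpi cospi sinpi opprK oppr0.
Qed.

Lemma theta_iter_ordS (i : 'I_N) (k : nat) :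
  cos (theta R (iter k (@ordS N) i)) = cos (theta R i + k%:R * h) /\
  sin (theta R (iter k (@ordS N) i)) = sin (theta R i + k%:R * h).
Proof.
elim: k => [|k [IHc IHs]] /=; first by rewrite mul0r addr0.
have [-> ->] := theta_ordS (iter k (@ordS N) i).
have -> : theta R i + k.+1%:R * h = theta R i + k%:R * h + h.
  by rewrite -natr1; ring.
by rewrite !cosD !sinD IHc IHs !cosD !sinD.
Qed.

Lemma dot_rvec_tvec_iter (i : 'I_N) (k : nat) :
  dot (rvec R i) (tvec R (iter k (@ordS N) i)) = - sin (k%:R * h).
Proof.
have [c s] := theta_iter_ordS i k.
rewrite /dot !mxE /= c s cosD sinD.
transitivity (- (cos (theta R i) ^+ 2 + sin (theta R i) ^+ 2) * sin (k%:R * h)).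
  by ring.
by rewrite cos2Dsin2 mulN1r.
Qed.

(** Summing s_(i+2) + s_i = 2 cos h s_(i+1) round the cycle gives (1 - cos h) times the sum equal to
    0, with cos h < 1. *)
Lemma sum_dot_tvec (u : 'rV[R]_2) : \sum_(i < N) dot u (tvec R i) = 0.
Proof.
pose s (i : 'I_N) := dot u (tvec R i); rewrite -/(\sum_i s i).
have sumS (f : 'I_N -> R) : \sum_i f i = \sum_i f (ordS i).
  by apply: reindex; apply: onW_bij; exact: ordS_bij.
have rec i : s (ordS (ordS i)) + s i = 2 * cos h * s (ordS i).
  rewrite /s /dot !mxE /=.
  have [-> ->] := theta_ordS (ordS i); rewrite !cosD !sinD.
  have [-> ->] := theta_ordS i; rewrite !cosD !sinD.
  have := cos2Dsin2 h; set c := cos h; set d := sin h => cd.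
  have {}cd : d ^+ 2 = 1 - c ^+ 2 by rewrite -cd; ring.
  by ring: cd.
have : \sum_i (s (ordS (ordS i)) + s i) = \sum_i (2 * cos h * s (ordS i)).
  by apply: eq_bigr => i _; exact: rec.
rewrite big_split -mulr_sumr /= -sumS.
rewrite -[\sum_i s (ordS (ordS i))](sumS (fun i => s (ordS i))) -sumS.
have := cos_angle_step_lt1 => c1 e; apply/eqP.
have : (1 - cos h) * \sum_i s i = 0 by lra.
by move=> /eqP; rewrite mulf_eq0 gt_eqF//= subr_gt0.
Qed.

Lemma cone_cover (u : 'rV[R]_2) : exists i : 'I_N, exists a, exists b,
  [/\ 0 <= a, 0 <= b & u = a *: rvec R i + b *: rvec R (ordS i)].
Proof.
pose s (i : 'I_N) := dot u (tvec R i); have sum_s : \sum_i s i = 0 := sum_dot_tvec u.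
have [i [si sSi]] : exists i, 0 <= s i /\ s (ordS i) <= 0.
  apply: contrapT => no.
  (* Without a sign change all values are positive or all are negative, against their zero sum. *)
  have sS i : 0 <= s i -> 0 < s (ordS i).
    by move=> si; rewrite ltNge; apply/negP => sSi; apply: no; exists i.
  have i0 : 'I_N by exists 0%N; apply: leq_trans N3.
  have [[i si]|neg] := pselect (exists i, 0 <= s i).
    have pos j : 0 < s j.
      have [k _ ->] := iter_ordS_surj (ordS i) j.
      by elim: k => [|k IHk] /=; apply: sS => //; exact: ltW.
    by have := pos i0; rewrite (psumr_eq0P _ sum_s) ?ltxx// => j _; exact: ltW.
  have {}neg j : 0 < - s j.
    by rewrite oppr_gt0 ltNge; apply/negP => sj; apply: neg; exists j.
  have := neg i0; rewrite (@psumr_eq0P _ _ xpredT (fun j => - s j)) ?ltxx//.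
    by move=> j _; exact: ltW.
  by rewrite sumrN sum_s oppr0.
have h0 := sin_angle_step_gt0.
(* Pairing u with t_(i+1) isolates the coefficient of r_i, pairing it with t_i that of r_(i+1). *)
exists i, (- s (ordS i) / sin h), (s i / sin h); split.
- by rewrite divr_ge0 ?oppr_ge0// ltW.
- by rewrite divr_ge0// ltW.
have hE : sin h * (cos (theta R i) ^+ 2 + sin (theta R i) ^+ 2) = sin h.
  by rewrite cos2Dsin2 mulr1.
have [c' s'] := theta_ordS i.
by apply: vec2_eq; rewrite /s /dot !mxE /= c' s' cosD sinD;
  apply: (mulfI (lt0r_neq0 h0)); rewrite -[in LHS]hE; field; rewrite gt_eqF.
Qed.

End RegularDirections.

(** * From signs of tangential components to valleys of the vertices *)

(** Only the edge across the sign change of [s] has an undetermined direction; it joins the descent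
    or the ascent according to its increment. *)
Lemma valley_of_sign_change (R : realType) (N m : nat) (f s c : 'I_N -> R) (i : 'I_N) :
  (forall j, 0 <= c j) ->
  (forall j, f (ordS j) - f j = c j * s j + c (ordS j) * s (ordS j)) ->
  (forall k, (k < N)%N -> let j := iter k (@ordS N) (ordS i) in
     if (k < m)%N then s j <= 0 else 0 <= s j) ->
  valley f i.
Proof.
move=> c0 fS sm; pose a k := iter k (@ordS N) (ordS i).
have dec k : (k.+1 < m)%N -> (k.+1 < N)%N -> f (a k.+1) <= f (a k).
  move=> km kN; rewrite -subr_le0 /a iterS fS -oppr_ge0 opprD -!mulrN.
  rewrite addr_ge0 ?mulr_ge0 ?oppr_ge0//.
    by have := sm k (ltnW kN); rewrite (ltnW km).
  by have := sm k.+1 kN; rewrite km.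
have inc k : (m <= k)%N -> (k.+1 < N)%N -> f (a k) <= f (a k.+1).
  move=> km kN; rewrite -subr_ge0 /a iterS fS addr_ge0 ?mulr_ge0//.
    by have := sm k (ltnW kN); rewrite ltnNge km.
  by have := sm k.+1 kN; rewrite ltnNge (leqW km).
have [fm|/ltW fm] := leP (f (a m)) (f (a m.-1)).
  exists m => k kN /=; have {}kN : (k.+1 < N)%N by lia.
  rewrite -/(a k) -[ordS (a k)]/(a k.+1); case: ltnP => km; last exact: inc.
  have [km1|km1] := ltnP k.+1 m; first exact: dec.
  have mk : m = k.+1 by lia.
  by move: fm; rewrite mk.
exists m.-1 => k kN /=; have {}kN : (k.+1 < N)%N by lia.
rewrite -/(a k) -[ordS (a k)]/(a k.+1); case: ltnP => km; first by apply: dec; lia.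
have [mk|mk] := leqP m k; first exact: inc.
have {}mk : m = k.+1 by lia.
by move: fm; rewrite mk.
Qed.

Section Vertices.
Variables (R : realType) (N : nat) (p : 'I_N -> R).
Hypothesis N3 : (3 <= N)%N.
Local Notation h := (angle_step R N).

(** Signed: the lines of indices i + 1 and i - 1 meet line i at t_i-coordinates (p_(i+1) - p_i cos
    h) / sin h and -(p_(i-1) - p_i cos h) / sin h, and this is half the difference. *)
Definition half_side (i : 'I_N) : R :=
  (p (ordS i) + p (ord_pred i) - 2 * p i * cos h) / (2 * sin h).

Lemma vertex_step (i : 'I_N) :
  vertex p (ordS i) - vertex p i =
  half_side i *: tvec R i + half_side (ordS i) *: tvec R (ordS i).
Proof.
have sh := lt0r_neq0 (sin_angle_step_gt0 R N3).
have hE : sin h ^+ 2 = 1 - cos h ^+ 2 by rewrite -(cos2Dsin2 h); ring.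
have [c' s'] := theta_ordS R N3 i.
by apply: vec2_eq; rewrite !mxE /= ordSK c' s' cosD sinD /half_side ordSK;
  field: hE.
Qed.

Lemma dot_vertex_step (u : 'rV[R]_2) (i : 'I_N) :
  dot u (vertex p (ordS i)) - dot u (vertex p i) =
  half_side i * dot u (tvec R i) + half_side (ordS i) * dot u (tvec R (ordS i)).
Proof. by rewrite -dotBr vertex_step dotDr !dotZr. Qed.

Hypothesis half_side_ge0 : forall i, 0 <= half_side i.

Lemma cone_valley (i : 'I_N) (a b : R) : 0 <= a -> 0 <= b ->
  valley (fun j => dot (a *: rvec R i + b *: rvec R (ordS i)) (vertex p j)) i.
Proof.
move=> a0 b0; set u := _ + _.
have sE k : dot u (tvec R (iter k (@ordS N) (ordS i))) =
    - (a * sin (k.+1%:R * h) + b * sin (k%:R * h)).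
  rewrite /u dotDl !dotZl dot_rvec_tvec_iter// -iterSr dot_rvec_tvec_iter//.
  by ring.
have s_le0 k : (k.+1.*2 <= N)%N -> dot u (tvec R (iter k (@ordS N) (ordS i))) <= 0.
  move=> kN; rewrite sE oppr_le0 addr_ge0// mulr_ge0// sin_multiple_ge0//; lia.
have s_ge0 k : (k < N)%N -> (N <= k.*2)%N ->
    0 <= dot u (tvec R (iter k (@ordS N) (ordS i))).
  move=> kN Nk; rewrite sE oppr_ge0 -oppr_ge0 opprD -!mulrN.
  by rewrite addr_ge0// mulr_ge0// oppr_ge0 sin_multiple_le0//; lia.
(* For odd N the sign at k = [N./2] depends on a and b, since kh < pi < (k+1)h; the boolean adds
   this index to the first run when the value there is at most 0. *)
apply: (@valley_of_sign_change _ _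
  (N./2 + (dot u (tvec R (iter N./2 (@ordS N) (ordS i))) <= 0)%R) _ _ _ _
  half_side_ge0 (dot_vertex_step u)) => k kN /=.
have [->|kN2] := eqVneq k N./2.
  by case: lerP => s0; rewrite ?addn1 ?ltnS ?addn0 ?ltnn ?leqnn// ltW.
have [kltN2|] := ltnP k N./2.
  by rewrite ltn_addr//; apply: s_le0; lia.
move=> Nk; case: ifP => [|_]; last by apply: s_ge0; lia.
by case: (_ <= _); lia.
Qed.

(** Turning the edge vector replaces t by r, which puts the normal in the i-th cone; for an edge of
    length 0, r_i serves. *)
Lemma vertex_support (i : 'I_N) : exists u, [/\ u != 0,
  vertex p (ordS i) != vertex p i -> u = turn (vertex p (ordS i) - vertex p i),
  dot u (vertex p i) = dot u (vertex p (ordS i)) &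
  valley (fun j => dot u (vertex p j)) i].
Proof.
have [Ai|Ai] := eqVneq (vertex p (ordS i)) (vertex p i).
  exists (rvec R i); split => //; last 2 first.
  - by rewrite Ai.
  - have := cone_valley i ler01 (lexx 0).
    by rewrite scale1r scale0r addr0.
  apply/eqP => /(congr1 (fun v => dot v v)).
  rewrite /dot !mxE /= -!expr2 cos2Dsin2 expr0n /= addr0 => /eqP.
  by rewrite oner_eq0.
exists (turn (vertex p (ordS i) - vertex p i)); split => //.
- apply: contra Ai => /eqP t0; rewrite -subr_eq0; set e := _ - _ in t0 *.
  have e1 : e 0 1 = 0 by have /rowP/(_ 0) := t0; rewrite !mxE.
  have e0 : e 0 0 = 0.
    by have /rowP/(_ 1) := t0; rewrite !mxE /= => /eqP; rewrite oppr_eq0 => /eqP.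
  by apply/eqP/vec2_eq; rewrite [RHS]mxE.
- by apply/eqP; rewrite eq_sym -subr_eq0 -dotBr dot_turn mulrC subrr.
rewrite vertex_step.
have -> : turn (half_side i *: tvec R i + half_side (ordS i) *: tvec R (ordS i)) =
    half_side i *: rvec R i + half_side (ordS i) *: rvec R (ordS i).
  by apply: vec2_eq; rewrite !mxE //=; ring.
exact: cone_valley.
Qed.

Lemma vertex_unimodal (u : 'rV[R]_2) :
  cyclically_unimodal (fun i => dot u (vertex p i)).
Proof.
(* [valley_unimodal] needs a valley of the opposite form, hence the cone of -u. *)
have [i [a [b [a0 b0 uE]]]] := cone_cover N3 (- u).
apply: (@valley_unimodal _ _ _ i).
have := cone_valley i a0 b0; rewrite -uE.
by congr valley; apply/funext => j; rewrite dotNl.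
Qed.

End Vertices.

Unset Implicit Arguments.

Theorem mainTheorem1 (R : realType) (N : nat) (hN : (3 <= N)%N) (p : 'I_N -> R)
    (hp : forall i : 'I_N,
       0 <= (p (ordS i) + p (ord_pred i) - 2 * p i * cos (angle_step R N))
            / (2 - 2 * cos (angle_step R N))) :
  convex_polygon (vertex p).
Proof.
have side_ge0 i : 0 <= half_side p i.
  have c1 : 0 < 2 - 2 * cos (angle_step R N).
    by have := cos_angle_step_lt1 R hN; lra.
  apply: divr_ge0; last by rewrite mulr_ge0// ltW// sin_angle_step_gt0.
  by have := hp i; rewrite pmulr_lge0 ?invr_gt0.
split; last first.
  move=> u; have := vertex_unimodal hN side_ge0 u^T.
  congr cyclically_unimodal; apply/funext => i.
  exact: dot_trmx.
exists (smallest (@convex_set R 'rV[R]_2) (range (vertex p))); split.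
  by case: N hN p {hp side_ge0} => // n _ p; exists n, (vertex p).
apply: polygonal_line_boundary (vertex_support hN side_ge0).
exact: leq_trans hN.
Qed.
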